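(* For every positive integer $t$, the vertex connectivity of the graph $\Gamma^t$ equals $2\cdot 4^t$.
   Context: All graphs are finite, simple and undirected. The vertex connectivity $\varkappa(G)$ of a graph $G$ is the minimum number of vertices whose deletion from $G$ disconnects it. For a positive integer $s$, let $J_s$ and $O_s$ denote the $s\times s$ all-ones matrix and zero matrix. Let $$H=\begin{bmatrix}-1&1&1&1\\ 1&-1&1&1\\ 1&1&-1&1\\ 1&1&1&-1\end{bmatrix},\qquad H'=\begin{bmatrix}1&1&1&-1\\ 1&1&-1&1\\ 1&-1&1&1\\ -1&1&1&1\end{bmatrix}.$$ Put $H_1=H$ and, for $t>1$, $H_t=H_{t-1}\otimes H'$ (Kronecker product). Then $H_t$ is a symmetric Hadamard matrix of order $4^t$ with all diagonal entries $-1$ and all row sums $2^t$. With $J=J_{4^t}$ and $O=O_{2\cdot 4^t}$, set $$M=\frac12\begin{bmatrix}J+H_t&J+H_t\\ J+H_t&J+H_t\end{bmatrix},\qquad N=\frac12\begin{bmatrix}J+H_t&J-H_t\\ J-H_t&J+H_t\end{bmatrix}.$$ The graph $\Gamma^t$ is the graph on $6\cdot 4^t$ vertices with adjacency matrix $$\begin{bmatrix}M&N&O\\ N&O&M\\ O&M&N\end{bmatrix}.$$ It is regular of degree $k=2\cdot 4^t+2^t$, and is a divisible design graph with parameters $(v,k,\lambda_1,\lambda_2,m,n)=(6\cdot 4^t,\,2\cdot 4^t+2^t,\,4^t+2^t,\,2\cdot 4^{t-1}+2^{t-1},\,3,\,2\cdot 4^t)$, meaning that its vertex set can be partitioned into $m$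 classes of size $n$ such that two distinct vertices in the same class have exactly $\lambda_1$ common neighbours and two vertices in different classes have exactly $\lambda_2$ common neighbours. *)

(* Defs.v *)
From mathcomp Require Import all_boot all_order all_algebra.
From mathcomp.real_closed Require Import mxtens.

Set Implicit Arguments.
Unset Strict Implicit.
Unset Printing Implicit Defensive.

Import Order.TTheory GRing.Theory Num.Theory.
Local Open Scope ring_scope.

Record sgraph (V : finType) := SGraph {
  adj :> rel V;
  adj_sym : symmetric adj;
  adj_irrefl : irreflexive adj
}.

Section Connectivity.
Variables (V : finType) (G : sgraph V).

Definition del_rel (S : {set V}) : rel V :=
  [rel x y | [&& x \notin S, y \notin S & G x y]].

Definition disconnects (S : {set V}) : bool :=
  [exists x in ~: S, exists y in ~: S, ~~ connect (del_rel S) x y].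

(* The default #|V|.-1 is the usual convention for complete graphs, which no   *)
(* vertex set disconnects. It never affects the minimum for other graphs: a    *)
(* disconnecting set misses at least two vertices.                             *)
Definition vertex_connectivity : nat :=
  \big[minn/#|V|.-1]_(S : {set V} | disconnects S) #|S|.

End Connectivity.

Definition H1_mx : 'M[rat]_4 := \matrix_(i, j) (if i == j then -1 else 1).

Definition H'_mx : 'M[rat]_4 :=
  \matrix_(i, j) (if (i + j == 3)%N then -1 else 1).

(* H_rec s is the matrix of order 4 ^ (s + 1). *)
Fixpoint H_rec (s : nat) : 'M[rat]_(4 ^ s.+1) :=
  if s is s'.+1 then
    castmx (esym (expnSr 4 s'.+1), esym (expnSr 4 s'.+1)) (H_rec s' *t H'_mx)
  else H1_mx.

(* Only t > 0 is meaningful; the value at t = 0 is a placeholder. *)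
Definition H_mx (t : nat) : 'M[rat]_(4 ^ t) :=
  if t is s.+1 then H_rec s else const_mx (-1).

Definition M_mx (t : nat) : 'M[rat]_(4 ^ t + 4 ^ t) :=
  let J := const_mx 1 in
  2^-1 *: block_mx (J + H_mx t) (J + H_mx t)
                   (J + H_mx t) (J + H_mx t).

Definition N_mx (t : nat) : 'M[rat]_(4 ^ t + 4 ^ t) :=
  let J := const_mx 1 in
  2^-1 *: block_mx (J + H_mx t) (J - H_mx t)
                   (J - H_mx t) (J + H_mx t).

Definition Gamma_order (t : nat) : nat :=
  (4 ^ t + 4 ^ t) + ((4 ^ t + 4 ^ t) + (4 ^ t + 4 ^ t)).

Lemma Gamma_orderE t : Gamma_order t = (6 * 4 ^ t)%N.
Proof. by rewrite /Gamma_order !mulSn mul0n addn0 !addnA. Qed.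

Definition Gamma_mx (t : nat) : 'M[rat]_(Gamma_order t) :=
  let M := M_mx t in let N := N_mx t in let O := 0 in
  block_mx M             (row_mx N O)
           (col_mx N O)  (block_mx O M
                                   M N).

Lemma H_mxSS t : H_mx t.+2 =
  castmx (esym (expnSr 4 t.+1), esym (expnSr 4 t.+1)) (H_mx t.+1 *t H'_mx).
Proof. by []. Qed.

Lemma H1_sym : H1_mx^T = H1_mx.
Proof. by apply/matrixP=> i j; rewrite !mxE eq_sym. Qed.

Lemma H'_sym : H'_mx^T = H'_mx.
Proof. by apply/matrixP=> i j; rewrite !mxE addnC. Qed.

Lemma H_sym t : (H_mx t)^T = H_mx t.
Proof.
elim: t => [|[|t] IH]; first by rewrite /= trmx_const.
  exact: H1_sym.
by rewrite H_mxSS trmx_cast /= trmx_tens IH H'_sym.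
Qed.

Lemma H_diag t i : H_mx t i i = -1.
Proof.
elim: t i => [|[|t] IH] i; first by rewrite mxE.
  by rewrite [H_mx 1]/= mxE eqxx.
rewrite H_mxSS castmxE; set k := cast_ord _ _.
case: (mxtens_indexP k) => a b.
rewrite tensmxE IH mxE; case: eqP; last by rewrite mulr1.
by move/(congr1 odd); rewrite addnn odd_double.
Qed.

Lemma H_pm1 t i j : (H_mx t i j == 1) || (H_mx t i j == -1).
Proof.
elim: t i j => [|[|t] IH] i j; first by rewrite mxE eqxx orbT.
  by rewrite [H_mx 1]/= mxE; case: ifP; rewrite eqxx ?orbT.
rewrite H_mxSS castmxE; set k := cast_ord _ _; set l := cast_ord _ _.
case: (mxtens_indexP k) => a b; case: (mxtens_indexP l) => c d.
rewrite tensmxE mxE; case/orP: (IH a c) => /eqP ->; case: ifP => _;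
  by rewrite ?mulr1 ?mulrNN ?mulr1 ?eqxx ?orbT.
Qed.

Lemma M_sym t : (M_mx t)^T = M_mx t.
Proof. by rewrite /M_mx linearZ /= tr_block_mx !raddfD /= trmx_const H_sym. Qed.

Lemma N_sym t : (N_mx t)^T = N_mx t.
Proof.
by rewrite /N_mx linearZ /= tr_block_mx !raddfD !raddfN /= trmx_const H_sym.
Qed.

Lemma Gamma_mx_sym t : (Gamma_mx t)^T = Gamma_mx t.
Proof.
by rewrite /Gamma_mx !tr_block_mx tr_col_mx tr_row_mx !trmx0 M_sym N_sym.
Qed.

Lemma split_mx_ind m n (P : 'I_(m + n) -> Prop) :
  (forall i, P (lshift n i)) -> (forall i, P (rshift m i)) -> forall i, P i.
Proof. by move=> Pl Pr i; rewrite -(splitK i); case: (split i) => j /=. Qed.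

Lemma M_diag t i : M_mx t i i = 0.
Proof.
elim/split_mx_ind: i => i;
  by rewrite mxE ?block_mxEul ?block_mxEdr !mxE H_diag addrN mulr0.
Qed.

Lemma N_diag t i : N_mx t i i = 0.
Proof.
elim/split_mx_ind: i => i;
  by rewrite mxE ?block_mxEul ?block_mxEdr !mxE H_diag addrN mulr0.
Qed.

Lemma Gamma_mx_diag t i : Gamma_mx t i i = 0.
Proof.
elim/split_mx_ind: i => [i|i]; first by rewrite block_mxEul M_diag.
rewrite block_mxEdr; elim/split_mx_ind: i => i; first by rewrite block_mxEul mxE.
by rewrite block_mxEdr N_diag.
Qed.

Definition Gamma_rel (t : nat) : rel 'I_(Gamma_order t) :=
  [rel x y | Gamma_mx t x y == 1].

Lemma Gamma_rel_sym t : symmetric (@Gamma_rel t).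
Proof. by move=> x y; rewrite /Gamma_rel /= -{1}Gamma_mx_sym mxE. Qed.

Lemma Gamma_rel_irrefl t : irreflexive (@Gamma_rel t).
Proof. by move=> x; rewrite /Gamma_rel /= Gamma_mx_diag. Qed.

Definition Gamma (t : nat) : sgraph 'I_(Gamma_order t) :=
  SGraph (@Gamma_rel_sym t) (@Gamma_rel_irrefl t).

Lemma M_01 t i j : (M_mx t i j == 0) || (M_mx t i j == 1).
Proof.
elim/split_mx_ind: i => i; elim/split_mx_ind: j => j;
  rewrite mxE ?block_mxEul ?block_mxEur ?block_mxEdl ?block_mxEdr !mxE;
  by case/orP: (H_pm1 i j) => /eqP ->.
Qed.

Lemma N_01 t i j : (N_mx t i j == 0) || (N_mx t i j == 1).
Proof.
elim/split_mx_ind: i => i; elim/split_mx_ind: j => j;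
  rewrite mxE ?block_mxEul ?block_mxEur ?block_mxEdl ?block_mxEdr !mxE;
  by case/orP: (H_pm1 i j) => /eqP ->.
Qed.

(* Gamma_mx t is the adjacency matrix of Gamma t in the usual 0/1 sense. *)
Lemma Gamma_adjE t x y : Gamma_mx t x y = (Gamma t x y)%:R.
Proof.
suff /orP[/eqP e|/eqP e] : (Gamma_mx t x y == 0) || (Gamma_mx t x y == 1).
- by rewrite /= /Gamma_rel /= e.
- by rewrite /= /Gamma_rel /= e.
elim/split_mx_ind: x => x; elim/split_mx_ind: y => y;
  rewrite ?block_mxEul ?block_mxEur ?block_mxEdl ?block_mxEdr ?M_01 //.
- by elim/split_mx_ind: y => y; rewrite ?row_mxEl ?row_mxEr ?N_01 // mxE eqxx.
- by elim/split_mx_ind: x => x; rewrite ?col_mxEu ?col_mxEd ?N_01 // mxE eqxx.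
elim/split_mx_ind: x => x; elim/split_mx_ind: y => y;
  rewrite ?block_mxEul ?block_mxEur ?block_mxEdl ?block_mxEdr ?M_01 ?N_01 //.
by rewrite mxE eqxx.
Qed.

(* Main.v *)
(** Write n = 4 ^ t, r = 2 ^ t, and split the vertices into the three blocks of
    size 2n. Deleting the middle block separates the other two. Conversely, let
    X and Y be nonempty disjoint sets with no edge between them. A vertex has n
    nonneighbours along a block N and n - r along a block M; two vertices have
    at most n / 2 common nonneighbours along N, and n / 2 - r along M unless
    they have the same M-neighbourhood, which happens only in pairs. So if both
    X and Y meet a block, they cover at most n - r + 2 vertices of the first
    block and at most n + 1 of the last one, and each nonempty X-part limits
    the Y-parts of the adjacent blocks. A case analysis on which of the six
    parts are empty gives |X| + |Y| <= 4n, so a disconnecting set has at least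
    2n elements. *)

Require Import Defs.
From mathcomp Require Import all_boot all_order all_algebra.
From mathcomp Require Import zify lra.
From mathcomp.real_closed Require Import mxtens.

Set Implicit Arguments.
Unset Strict Implicit.
Unset Printing Implicit Defensive.

Import Order.TTheory GRing.Theory Num.Theory.
Local Open Scope ring_scope.

(** * Row sums and row orthogonality of the Hadamard matrices *)

Section Hadamard.

Lemma sum_H1_row i : \sum_j H1_mx i j = 2.
Proof. by rewrite !big_ord_recl big_ord0 !mxE; case: i => [[|[|[|[]]]]]. Qed.

Lemma sum_H'_row i : \sum_j H'_mx i j = 2.
Proof. by rewrite !big_ord_recl big_ord0 !mxE; case: i => [[|[|[|[]]]]]. Qed.

Lemma H1_dot i k : \sum_j H1_mx i j * H1_mx k j = (4 * (i == k))%:R.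
Proof.
by rewrite !big_ord_recl big_ord0 !mxE;
  case: i => [[|[|[|[]]]]] //; case: k => [[|[|[|[]]]]].
Qed.

Lemma H'_dot i k : \sum_j H'_mx i j * H'_mx k j = (4 * (i == k))%:R.
Proof.
by rewrite !big_ord_recl big_ord0 !mxE;
  case: i => [[|[|[|[]]]]] //; case: k => [[|[|[|[]]]]].
Qed.

(** The coordinates of an index in the two Kronecker factors, with the cast between the orders
    hidden. *)
Definition H_index t (i : 'I_(4 ^ t.+2)) : 'I_(4 ^ t.+1) * 'I_4 :=
  mxtens_unindex (cast_ord (expnSr 4 t.+1) i).

Lemma H_index_inj t : injective (@H_index t).
Proof.
exact: inj_comp (can_inj (@mxtens_unindexK _ _)) (@cast_ord_inj _ _ _).
Qed.

Lemma H_mxSSE t i j : H_mx t.+2 i j =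
  H_mx t.+1 (H_index i).1 (H_index j).1 * H'_mx (H_index i).2 (H_index j).2.
Proof. by rewrite H_mxSS castmxE mxE !esymK. Qed.

(** This makes row sums and inner products of rows multiplicative under the Kronecker product, which
    drives both inductions below. *)
Lemma sum_H_index t (F : 'I_(4 ^ t.+1) -> rat) (G : 'I_4 -> rat) :
  \sum_i F (H_index i).1 * G (H_index i).2 = (\sum_i F i) * (\sum_i G i).
Proof.
rewrite mulr_sum (reindex (cast_ord (expnSr 4 t.+1))) //=.
by apply: onW_bij; exists (cast_ord (esym (expnSr 4 t.+1)));
   [exact: cast_ordK | exact: cast_ordKV].
Qed.

Lemma sum_H_row t i : (0 < t)%N -> \sum_j H_mx t i j = (2 ^ t)%:R.
Proof.
case: t i => [|t] // i _; elim: t i => [|t IH] i; first exact: sum_H1_row.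
under eq_bigr => j _ do rewrite H_mxSSE.
by rewrite sum_H_index IH sum_H'_row [in RHS]expnSr natrM.
Qed.

Lemma H_dot t i k : (0 < t)%N ->
  \sum_j H_mx t i j * H_mx t k j = (4 ^ t * (i == k))%:R.
Proof.
case: t i k => [|t] // i k _; elim: t i k => [|t IH] i k; first exact: H1_dot.
under eq_bigr => j _ do rewrite !H_mxSSE mulrACA.
rewrite (sum_H_index (fun j => H_mx t.+1 _ j * H_mx t.+1 _ j)
                     (fun j => H'_mx _ j * H'_mx _ j)) IH H'_dot -natrM.
(* The two Kronecker deltas merge into one on index pairs, and [H_index] is injective. *)
rewrite mulnACA -expnSr mulnb -xpair_eqE -!surjective_pairing.
by rewrite (inj_eq (@H_index_inj t)).
Qed.

End Hadamard.

(** * Twin pairs in a block of size 2n *)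

Section Doubling.
Variable n : nat.

(* M depends only on the twin classes of its indices; in N, twins have
   complementary rows. *)
Definition twin_class (u : 'I_(n + n)) : 'I_n :=
  match split u with inl i => i | inr i => i end.

Definition twin_sign (u : 'I_(n + n)) : rat :=
  match split u with inl _ => 1 | inr _ => -1 end.

Lemma twin_classL i : twin_class (lshift n i) = i.
Proof. by rewrite /twin_class (unsplitK (inl i)). Qed.

Lemma twin_classR i : twin_class (rshift n i) = i.
Proof. by rewrite /twin_class (unsplitK (inr i)). Qed.

Lemma twin_signL i : twin_sign (lshift n i) = 1.
Proof. by rewrite /twin_sign (unsplitK (inl i)). Qed.

Lemma twin_signR i : twin_sign (rshift n i) = -1.
Proof. by rewrite /twin_sign (unsplitK (inr i)). Qed.

Definition twinE := (twin_classL, twin_classR, twin_signL, twin_signR).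

(** Each class has one member of each sign. Terms odd in the sign therefore cancel in sums over a
    block. *)
Lemma sum_twin (F : 'I_n -> rat -> rat) :
  \sum_u F (twin_class u) (twin_sign u) = \sum_i (F i 1 + F i (-1)).
Proof.
rewrite big_split_ord big_split /=.
by congr (_ + _); apply: eq_bigr => i _; rewrite !twinE.
Qed.

Lemma twin_neq u v : twin_class u = twin_class v -> u != v ->
  twin_sign u * twin_sign v = -1.
Proof.
by elim/split_mx_ind: u => i; elim/split_mx_ind: v => j;
  rewrite !twinE => ->; rewrite ?eqxx ?mulr1 ?mul1r.
Qed.

(** A twin class has only two members, so it cannot contain [X]. *)
Lemma two_twin_classes (X : {set 'I_(n + n)}) : (2 < #|X|)%N ->
  exists u v, [/\ u \in X, v \in X & twin_class u != twin_class v].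
Proof.
move=> X_gt2; have [u uX] : exists u, u \in X by apply/card_gt0P; lia.
have /subsetPn[v vX] :
    ~~ (X \subset [set lshift n (twin_class u); rshift n (twin_class u)]).
  by apply: contraTN X_gt2 => /subset_leq_card; rewrite cards2; lia.
move=> v_out; exists u, v; split=> //; apply: contraNneq v_out => ->.
by elim/split_mx_ind: v {vX} => j; rewrite !twinE !inE eqxx ?orbT.
Qed.

End Doubling.

(** [X] and [Y] may stand for parts of two different blocks joined by [A], so disjointness is not
    part of the definition. *)
Definition separated m (A : 'M[rat]_m) (X Y : {set 'I_m}) :=
  forall u v, u \in X -> v \in Y -> A u v = 0.

Lemma separated_sym m (A : 'M[rat]_m) X Y :
  A^T = A -> separated A X Y -> separated A Y X.
Proof. by move=> A_sym XY u v uY vX; rewrite -A_sym mxE XY. Qed.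

(** * Counting nonneighbours and common nonneighbours along M and N *)

Section Counting.
Variable t : nat.
Hypothesis t_gt0 : (0 < t)%N.
Local Notation n := (4 ^ t)%N.
Local Notation r := (2 ^ t)%N.

Lemma M_mxE u v :
  M_mx t u v = 2^-1 * (1 + H_mx t (twin_class u) (twin_class v)).
Proof.
by elim/split_mx_ind: u => i; elim/split_mx_ind: v => j;
  rewrite mxE ?block_mxEul ?block_mxEur ?block_mxEdl ?block_mxEdr !mxE !twinE.
Qed.

Lemma N_mxE u v : N_mx t u v =
  2^-1 * (1 + twin_sign u * twin_sign v * H_mx t (twin_class u) (twin_class v)).
Proof.
by elim/split_mx_ind: u => i; elim/split_mx_ind: v => j;
  rewrite mxE ?block_mxEul ?block_mxEur ?block_mxEdl ?block_mxEdr !mxE !twinE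
    ?mulrNN ?mulr1 ?mul1r ?mulN1r.
Qed.

Lemma sum1_n : \sum_(j < n) 1 = n%:R :> rat.
Proof. by rewrite sumr_const card_ord. Qed.

(** Twins have complementary entries in the row of [u], so each class contributes exactly 1. *)
Lemma N_nonneighbors u : \sum_v (1 - N_mx t u v) = n%:R.
Proof.
under eq_bigr => v _ do rewrite N_mxE.
rewrite (sum_twin (fun j s => 1 - 2^-1 * (1 + twin_sign u * s * H_mx t _ j))).
by rewrite -sum1_n; apply: eq_bigr => j _; lra.
Qed.

(** Summed over twin pairs, the products give n / 2 plus half the inner product of two rows of H,
    weighted by the signs of [u] and [v]. Orthogonality makes the second term 0 for distinct
    classes; for twins it is -n / 2, hence only an inequality. *)
Lemma N_common_nonneighbors u v : u != v ->
  \sum_w (1 - N_mx t u w) * (1 - N_mx t v w) <= n%:R / 2.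
Proof.
move=> u_v; under eq_bigr => w _ do rewrite !N_mxE.
rewrite (sum_twin (fun j s => (1 - 2^-1 * (1 + twin_sign u * s * H_mx t _ j)) *
                              (1 - 2^-1 * (1 + twin_sign v * s * H_mx t _ j)))).
set a := twin_class u; set b := twin_class v.
rewrite [leLHS](_ : _ = n%:R / 2 +
    twin_sign u * twin_sign v / 2 * \sum_j H_mx t a j * H_mx t b j); last first.
  rewrite -sum1_n mulr_suml mulr_sumr -big_split /=.
  by apply: eq_bigr => j _; lra.
rewrite H_dot //; case: eqP => [/twin_neq/(_ u_v) -> | _].
  by have := ler0n rat n; rewrite muln1; lra.
by rewrite muln0; lra.
Qed.

(** Twins have equal entries here, so a class contributes 1 minus an entry of H, and the row sum of
    H is r. *)
Lemma M_nonneighbors u : \sum_v (1 - M_mx t u v) = n%:R - r%:R.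
Proof.
under eq_bigr => v _ do rewrite M_mxE.
rewrite (sum_twin (fun j s => 1 - 2^-1 * (1 + H_mx t _ j))).
rewrite -sum1_n -(sum_H_row (twin_class u) t_gt0) -sumrB.
by apply: eq_bigr => j _; lra.
Qed.

(** A class with entries a and b in the two rows of H contributes (1 - a - b + a b) / 2. The row
    sums give -r in total and orthogonality removes the product term. *)
Lemma M_common_nonneighbors u v : twin_class u != twin_class v ->
  \sum_w (1 - M_mx t u w) * (1 - M_mx t v w) = n%:R / 2 - r%:R.
Proof.
move=> u_v; under eq_bigr => w _ do rewrite !M_mxE.
rewrite (sum_twin (fun j s => (1 - 2^-1 * (1 + H_mx t _ j)) *
                              (1 - 2^-1 * (1 + H_mx t _ j)))).
set a := twin_class u; set b := twin_class v.
transitivity (n%:R / 2 - 2^-1 * (\sum_j H_mx t a j) - 2^-1 * (\sum_j H_mx t b j)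
              + 2^-1 * \sum_j H_mx t a j * H_mx t b j); last first.
  by rewrite !sum_H_row // H_dot // (negPf u_v) muln0; lra.
rewrite -sum1_n mulr_suml !mulr_sumr -!sumrB -big_split /=.
by apply: eq_bigr => j _; lra.
Qed.

(** Applied with [f] the indicator of the nonneighbours of one vertex, or of the common
    nonneighbours of two. *)
Lemma card_le_sum (T : finType) (Y : {set T}) (f : T -> rat) :
  (forall y, 0 <= f y) -> (forall y, y \in Y -> f y = 1) ->
  #|Y|%:R <= \sum_y f y.
Proof.
move=> f_ge0 f_Y; rewrite (bigID (mem Y)) /= (eq_bigr (fun=> 1)) //.
by rewrite sumr_const lerDl sumr_ge0.
Qed.

Section Separated.
Variables X Y : {set 'I_(n + n)}.

Lemma M_subr_ge0 u v : 0 <= 1 - M_mx t u v.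
Proof. by case/orP: (M_01 u v) => /eqP->. Qed.

Lemma N_subr_ge0 u v : 0 <= 1 - N_mx t u v.
Proof. by case/orP: (N_01 u v) => /eqP->. Qed.

Lemma M_separated1 : separated (M_mx t) X Y ->
  (0 < #|X|)%N -> (#|Y| + r <= n)%N.
Proof.
move=> XY /card_gt0P[u uX].
rewrite -(ler_nat rat) natrD -lerBrDr -(M_nonneighbors u).
by apply: card_le_sum => v; [exact: M_subr_ge0 | move=> vY; rewrite XY ?subr0].
Qed.

(** Two vertices of [X] could be twins with the same M-neighbourhood; three always include two that
    are not. *)
Lemma M_separated3 : separated (M_mx t) X Y ->
  (2 < #|X|)%N -> (2 * (#|Y| + r) <= n)%N.
Proof.
move=> XY /two_twin_classes[u [v [uX vX u_v]]].
rewrite -(ler_nat rat) natrM natrD.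
suff : #|Y|%:R <= n%:R / 2 - r%:R :> rat by lra.
rewrite -(M_common_nonneighbors u_v); apply: card_le_sum => w.
  by rewrite mulr_ge0 ?M_subr_ge0.
by move=> wY; rewrite !XY // subr0 mulr1.
Qed.

Lemma N_separated1 : separated (N_mx t) X Y ->
  (0 < #|X|)%N -> (#|Y| <= n)%N.
Proof.
move=> XY /card_gt0P[u uX]; rewrite -(ler_nat rat) -(N_nonneighbors u).
by apply: card_le_sum => v; [exact: N_subr_ge0 | move=> vY; rewrite XY ?subr0].
Qed.

Lemma N_separated2 : separated (N_mx t) X Y ->
  (1 < #|X|)%N -> (2 * #|Y| <= n)%N.
Proof.
move=> XY /card_gt1P[u [v [uX vX u_v]]].
rewrite -(ler_nat rat) natrM.
suff : #|Y|%:R <= n%:R / 2 :> rat by lra.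
apply: le_trans (N_common_nonneighbors u_v).
apply: card_le_sum => w; first by rewrite mulr_ge0 ?N_subr_ge0.
by move=> wY; rewrite !XY // subr0 mulr1.
Qed.

End Separated.
End Counting.

(** * Size bounds for separated pairs *)

Section Separation.
Variable t : nat.
Hypothesis t_gt0 : (0 < t)%N.
Local Notation n := (4 ^ t)%N.
Local Notation r := (2 ^ t)%N.
Variables X Y : {set 'I_(n + n)}.

Lemma r_ge2 : (2 <= r)%N.
Proof. by rewrite -{1}(expn1 2) leq_exp2l. Qed.

Lemma M_separated : separated (M_mx t) X Y ->
  ((0 < #|X|)%N -> (#|Y| + r <= n)%N) /\ ((0 < #|Y|)%N -> (#|X| + r <= n)%N).
Proof.
move=> XY; split; first exact: M_separated1.
by apply: M_separated1 => //; apply: separated_sym (@M_sym t) XY.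
Qed.

Lemma N_separated : separated (N_mx t) X Y ->
  ((0 < #|X|)%N -> (#|Y| <= n)%N) /\ ((0 < #|Y|)%N -> (#|X| <= n)%N).
Proof.
move=> XY; split; first exact: N_separated1.
by apply: N_separated1; apply: separated_sym (@N_sym t) XY.
Qed.

(** If both sets have at least 3 elements, each has at most n / 2 - r. Otherwise one has at most 2
    and the other at most n - r. *)
Lemma M_loop_separated : separated (M_mx t) X Y ->
  (0 < #|X|)%N -> (0 < #|Y|)%N -> (#|X| + #|Y| + r <= n.+2)%N.
Proof.
move=> XY; have YX := separated_sym (@M_sym t) XY.
have := M_separated3 t_gt0 XY; have := M_separated3 t_gt0 YX.
by have [] := M_separated XY; have := r_ge2; lia.
Qed.

(** If both sets have at least 2 elements, each has at most n / 2. Otherwise one is a singleton and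
    the other has at most n elements. *)
Lemma N_loop_separated : separated (N_mx t) X Y ->
  (0 < #|X|)%N -> (0 < #|Y|)%N -> (#|X| + #|Y| <= n.+1)%N.
Proof.
move=> XY; have YX := separated_sym (@N_sym t) XY.
have := N_separated2 t_gt0 XY; have := N_separated2 t_gt0 YX.
by have [] := N_separated XY; lia.
Qed.

End Separation.

(** The arithmetic of the case analysis, with [xi] and [yi] the sizes of the parts in block i. The
    condition [1 < r] is sharp when only [x1] and [x2] vanish: the bounds then add up to (n + 2 - r)
    + n + 2n. *)
Lemma separated_sizes (n r x0 x1 x2 y0 y1 y2 : nat) :
  (x0 + y0 <= 2 * n -> x1 + y1 <= 2 * n -> x2 + y2 <= 2 * n ->
  (0 < x0 -> y0 + r <= n) -> (0 < y0 -> x0 + r <= n) ->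
  (0 < x1 -> y2 + r <= n) -> (0 < y2 -> x1 + r <= n) ->
  (0 < x2 -> y1 + r <= n) -> (0 < y1 -> x2 + r <= n) ->
  (0 < x0 -> y1 <= n) -> (0 < y1 -> x0 <= n) ->
  (0 < x1 -> y0 <= n) -> (0 < y0 -> x1 <= n) ->
  (0 < x2 -> y2 <= n) -> (0 < y2 -> x2 <= n) ->
  (0 < x0 -> 0 < y0 -> x0 + y0 + r <= n.+2) ->
  (0 < x2 -> 0 < y2 -> x2 + y2 <= n.+1) -> 1 < r ->
  0 < x0 + x1 + x2 -> 0 < y0 + y1 + y2 ->
  x0 + x1 + x2 + (y0 + y1 + y2) <= 4 * n)%N.
Proof.
move=> *; case: (posnP x0) => ?; case: (posnP x1) => ?; case: (posnP x2) => ?;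
  case: (posnP y0) => ?; case: (posnP y1) => ?; case: (posnP y2) => ?;
  (* Once it is fixed which parts are empty, each implication either has a false premise or becomes
     a linear inequality. *)
  subst => //;
  repeat match goal with
  | H : is_true (0 < 0)%N -> _ |- _ => clear H
  | H : is_true (0 < ?x)%N -> _, x_gt0 : is_true (0 < ?x)%N |- _ =>
      specialize (H x_gt0)
  end; lia.
Qed.

(** * From the blocks to disconnecting sets of the graph *)

Section Gamma.
Variable t : nat.
Hypothesis t_gt0 : (0 < t)%N.
Local Notation n := (4 ^ t)%N.
Local Notation r := (2 ^ t)%N.
Local Notation V := 'I_(Gamma_order t).
Local Notation m := (n + n)%N.

Definition block0 : 'I_m -> V := @lshift m (m + m).
Definition block1 (u : 'I_m) : V := @rshift m (m + m) (lshift m u).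
Definition block2 (u : 'I_m) : V := @rshift m (m + m) (rshift m u).

Lemma block_ind (P : V -> Prop) : (forall u, P (block0 u)) ->
  (forall u, P (block1 u)) -> (forall u, P (block2 u)) -> forall x, P x.
Proof.
by move=> P0 P1 P2; apply: split_mx_ind => // u; elim/split_mx_ind: u.
Qed.

Lemma card_blocks (X : {set V}) :
  #|X| = (#|block0 @^-1: X| + #|block1 @^-1: X| + #|block2 @^-1: X|)%N.
Proof.
rewrite -!sum1_card -[RHS]addnA big_split_ord /=.
congr addn; first by apply: eq_bigl => u; rewrite inE.
by rewrite big_split_ord; congr addn; apply: eq_bigl => u; rewrite inE.
Qed.

Lemma Gamma00 u v : Gamma_mx t (block0 u) (block0 v) = M_mx t u v.
Proof. exact: block_mxEul. Qed.

Lemma Gamma01 u v : Gamma_mx t (block0 u) (block1 v) = N_mx t u v.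
Proof. by rewrite /Gamma_mx block_mxEur row_mxEl. Qed.

Lemma Gamma02 u v : Gamma_mx t (block0 u) (block2 v) = 0.
Proof. by rewrite /Gamma_mx block_mxEur row_mxEr mxE. Qed.

Lemma Gamma12 u v : Gamma_mx t (block1 u) (block2 v) = M_mx t u v.
Proof. by rewrite /Gamma_mx block_mxEdr block_mxEur. Qed.

Lemma Gamma22 u v : Gamma_mx t (block2 u) (block2 v) = N_mx t u v.
Proof. by rewrite /Gamma_mx !block_mxEdr. Qed.

Lemma card_separated (X Y : {set V}) : [disjoint X & Y] ->
  (forall x y, x \in X -> y \in Y -> ~~ Gamma t x y) ->
  (0 < #|X|)%N -> (0 < #|Y|)%N -> (#|X| + #|Y| <= 4 * n)%N.
Proof.
move=> dXY sepXY.
have XY0 x y : x \in X -> y \in Y -> Gamma_mx t x y = 0.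
  by move=> xX yY; rewrite Gamma_adjE (negPf (sepXY _ _ xX yY)).
have YX0 y x : y \in Y -> x \in X -> Gamma_mx t y x = 0.
  by move=> yY xX; rewrite -Gamma_mx_sym mxE XY0.
(* Disjointness of [X] and [Y] enters here: their parts share a block of 2n vertices. *)
have block_le (b : 'I_m -> V) : (#|b @^-1: X| + #|b @^-1: Y| <= 2 * n)%N.
  have [_] := leq_card_setU (b @^-1: X) (b @^-1: Y).
  rewrite -setI_eq0 -preimsetI (disjoint_setI0 dXY) preimset0 eqxx => /eqP <-.
  by apply: leq_trans (max_card _) _; rewrite card_ord mul2n -addnn.
have le0 := block_le block0; have le1 := block_le block1.
have le2 := block_le block2.
rewrite !card_blocks.
set X0 := block0 @^-1: X in le0 *; set X1 := block1 @^-1: X in le1 *.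
set X2 := block2 @^-1: X in le2 *; set Y0 := block0 @^-1: Y in le0 *.
set Y1 := block1 @^-1: Y in le1 *; set Y2 := block2 @^-1: Y in le2 *.
(* One relation for each of the six nonzero blocks of [Gamma_mx]; those below the diagonal come by
   symmetry. *)
have s00 : separated (M_mx t) X0 Y0.
  by move=> u v; rewrite !inE -Gamma00; exact: XY0.
have s01 : separated (N_mx t) X0 Y1.
  by move=> u v; rewrite !inE -Gamma01; exact: XY0.
have s10 : separated (N_mx t) X1 Y0.
  apply: separated_sym; first exact: N_sym.
  by move=> u v; rewrite !inE -Gamma01; exact: YX0.
have s12 : separated (M_mx t) X1 Y2.
  by move=> u v; rewrite !inE -Gamma12; exact: XY0.
have s21 : separated (M_mx t) X2 Y1.
  apply: separated_sym; first exact: M_sym.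
  by move=> u v; rewrite !inE -Gamma12; exact: YX0.
have s22 : separated (N_mx t) X2 Y2.
  by move=> u v; rewrite !inE -Gamma22; exact: XY0.
have [a00 b00] := M_separated t_gt0 s00.
have [a12 b12] := M_separated t_gt0 s12.
have [a21 b21] := M_separated t_gt0 s21; have [a01 b01] := N_separated s01.
have [a10 b10] := N_separated s10; have [a22 b22] := N_separated s22.
exact: (separated_sizes le0 le1 le2 a00 b00 a12 b12 a21 b21 a01 b01 a10 b10
  a22 b22 (M_loop_separated t_gt0 s00) (N_loop_separated t_gt0 s22)
  (r_ge2 t_gt0)).
Qed.

Lemma middle_block_disconnects : disconnects (Gamma t) (block1 @: setT).
Proof.
have block0_out u : block0 u \notin block1 @: setT.
  (* The blocks are consecutive intervals of indices, so comparing values tells them apart. *)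
  apply/imsetP => -[v _ /(congr1 val)] /=; have := ltn_ord u; lia.
have block2_out u : block2 u \notin block1 @: setT.
  apply/imsetP => -[v _ /(congr1 val)] /=; have := ltn_ord v; lia.
have nonadj02 u v : Gamma t (block0 u) (block2 v) = false.
  by rewrite -[LHS]/(Gamma_mx t _ _ == 1) Gamma02.
have n_gt0 : (0 < m)%N by rewrite addn_gt0 expn_gt0.
apply/existsP; exists (block0 (Ordinal n_gt0)); rewrite inE block0_out /=.
apply/existsP; exists (block2 (Ordinal n_gt0)); rewrite inE block2_out /=.
(* After the deletion no edge leaves block 0, so a path starting there cannot reach block 2. *)
apply/negP => /(@closed_connect _ _ [pred x | x \in block0 @: setT]) in_block0.
have /in_block0 : closed (del_rel (Gamma t) (block1 @: setT))
                         [pred x | x \in block0 @: setT].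
  move=> x y /= /and3P[]; rewrite !inE.
  have mem0 u : block0 u \in block0 @: setT by rewrite imset_f.
  have mem2 u : (block2 u \in block0 @: setT) = false.
    apply/imsetP => -[v _ /(congr1 val)] /=; have := ltn_ord v; lia.
  elim/block_ind: x => u; rewrite ?imset_f //; elim/block_ind: y => v;
    rewrite ?imset_f // ?mem0 ?mem2 //.
    by rewrite nonadj02.
  by rewrite adj_sym nonadj02.
rewrite !inE imset_f // => /esym/imsetP[v _ /(congr1 val)] /=.
by have := ltn_ord v; lia.
Qed.

Lemma card_middle_block : #|block1 @: setT| = (2 * n)%N.
Proof.
rewrite card_imset; first by rewrite cardsT card_ord mul2n addnn.
exact: (inj_comp (@rshift_inj _ _) (@lshift_inj _ _)).
Qed.

Lemma card_disconnects (S : {set V}) :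
  disconnects (Gamma t) S -> (2 * n <= #|S|)%N.
Proof.
move=> /existsP[x]; rewrite inE => /andP[xS /existsP[y]].
rewrite inE => /andP[yS Nxy].
(* [X] is the component of [x] after deleting [S]; the remaining vertices outside [S] include [y].
   Together they number 6n - |S|, so a bound of 4n suffices. *)
pose X := [set z in ~: S | connect (del_rel (Gamma t) S) x z].
have XS : X \subset ~: S by apply/subsetP => z; rewrite inE => /andP[].
have : (#|X| + #|~: S :\: X| <= 4 * n)%N.
  apply: card_separated.
  - by rewrite -setI_eq0 setDE setICA setICr setI0.
  - move=> a b; rewrite !inE => /andP[aS xa] /andP[+ bS].
    rewrite bS /=; apply: contraNN => ab.
    by apply: (connect_trans xa); apply: connect1; rewrite /del_rel /= aS bS.
  - by apply/card_gt0P; exists x; rewrite !inE xS connect0.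
  by apply/card_gt0P; exists y; rewrite !inE yS (negPf Nxy).
rewrite cardsDS // subnKC ?subset_leq_card //.
have := Gamma_orderE t; have := cardsC S; rewrite card_ord; lia.
Qed.

End Gamma.

Theorem theorem1 (t : nat) (ht : (0 < t)%N) :
  vertex_connectivity (Gamma t) = (2 * 4 ^ t)%N.
Proof.
apply/eqP; rewrite eqn_leq; apply/andP; split.
  have := bigmin_le_cond #|'I_(Gamma_order t)|.-1
    (fun S : {set 'I_(Gamma_order t)} => #|S|) (middle_block_disconnects ht).
  by rewrite minEnat leEnat card_middle_block.
apply: (big_ind (fun k => 2 * 4 ^ t <= k)%N) => [|j k|S].
(* The default value of the minimum, here 6n - 1, must satisfy the lower bound too. *)
- by rewrite card_ord Gamma_orderE; have := expn_gt0 4 t; lia.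
- by rewrite leq_min => -> ->.
exact: card_disconnects.
Qed.
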